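(* Let $A\in\mathbb{C}^{n\times n}$ be Hermitian positive semi-definite with eigenvalue decomposition $A=U\Lambda U^*$, $U$ unitary, $\Lambda=\mathrm{diag}(\lambda_1,\dots,\lambda_n)$, $\lambda_1\ge\cdots\ge\lambda_n$, and let $k$ satisfy $\lambda_k>\lambda_{k+1}>0$. Partition $U=(U_1,U_2)$ with $U_1\in\mathbb{C}^{n\times k}$ and let $\Lambda_2=\mathrm{diag}(\lambda_{k+1},\dots,\lambda_n)$. Let $q\ge1$, $k\le l\le n$, and let $\Omega\in\mathbb{C}^{n\times l}$ be any matrix such that $\widehat\Omega_1=U_1^*\Omega$ has rank $k$ and $K_q=(A\Omega,A^2\Omega,\dots,A^q\Omega)$ has full column rank $ql$. Let $\widehat\Omega_2=U_2^*\Omega$, let $K_q=Q_qR_q$ be the thin QR factorization and $T=Q_q^*AQ_q\in\mathbb{C}^{ql\times ql}$. Then $$0\le\log\det(I_n+A)-\log\det(I_{ql}+T)\le\log\det(I_{n-k}+\eta\Lambda_2)+\log\det(I_{n-k}+\Lambda_2),$$ where $\eta=\frac{\lambda_{k+1}}{\lambda_k}T_{q-1}^{-2}\!\left(\frac{2\lambda_k-\lambda_{k+1}}{\lambda_{k+1}}\right)\|\widehat\Omega_2\widehat\Omega_1^\dagger\|_2^2$.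
   Context: $X^\dagger$ denotes the Moore–Penrose inverse and $\|\cdot\|_2$ the spectral norm. $T_m$ is the Chebyshev polynomial of the first kind of degree $m$; for $x\ge1$, $T_m(x)=\frac{(x+\sqrt{x^2-1})^m+(x-\sqrt{x^2-1})^m}{2}$, and $T_m^{-2}(x)=1/T_m(x)^2$. *)

(* Defs.v *)
From HB Require Import structures.
From mathcomp Require Import all_boot all_order all_algebra.
From mathcomp Require Import all_classical all_reals.
From mathcomp Require Import exp.
From mathcomp Require Import complex.
Set Implicit Arguments. Unset Strict Implicit. Unset Printing Implicit Defensive.
Import Order.TTheory GRing.Theory Num.Theory.
Local Open Scope ring_scope.
Local Open Scope complex_scope.

Definition ctrmx (R : rcfType) m n (M : 'M[R[i]]_(m, n)) : 'M[R[i]]_(n, m) :=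
  map_mx (@conjc R) M^T.

Definition hermitian (R : rcfType) n (A : 'M[R[i]]_n) := ctrmx A = A.
Definition psd (R : rcfType) n (A : 'M[R[i]]_n) :=
  hermitian A /\ forall x : 'cV[R[i]]_n, 0 <= complex.Re ((ctrmx x *m A *m x) 0 0).
Definition orthonormal_cols (R : rcfType) m n (Q : 'M[R[i]]_(m, n)) :=
  ctrmx Q *m Q = 1%:M.

Definition mp_inverse (R : rcfType) m n (X : 'M[R[i]]_(m, n)) (Y : 'M[R[i]]_(n, m)) :=
  [/\ X *m Y *m X = X, Y *m X *m Y = Y,
      ctrmx (X *m Y) = X *m Y & ctrmx (Y *m X) = Y *m X].

Definition vnorm2 (R : rcfType) n (v : 'cV[R[i]]_n) : R :=
  \sum_(i < n) (complex.Re (v i 0) ^+ 2 + complex.Im (v i 0) ^+ 2).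
Definition spec_norm (R : realType) m n (X : 'M[R[i]]_(m, n)) : R :=
  sup [set Num.sqrt (vnorm2 (X *m x)) / Num.sqrt (vnorm2 x) | x in [set x : 'cV[R[i]]_n | x != 0]]%classic.

(* log det of a matrix whose determinant is real positive *)
Definition logdet (R : realType) n (M : 'M[R[i]]_n) : R := ln (complex.Re (\det M)).

Fixpoint cheb_pair (R : pzRingType) (m : nat) (x : R) : R * R :=
  match m with
  | 0%N => (1, x)
  | m'.+1 => let p := cheb_pair m' x in (p.2, 2 * x * p.2 - p.1)
  end.
Definition chebT (R : pzRingType) (m : nat) (x : R) : R := (cheb_pair m x).1.

(* Krylov matrix K_q = (A Om, A^2 Om, ..., A^q Om) : column j = p*l + c is column c of A^(p+1) Om *)
Lemma krylov_idx_proof q l (j : 'I_(q * l)) : (j %% l < l)%N.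
Proof.
apply: ltn_pmod; have := leq_ltn_trans (leq0n j) (ltn_ord j).
by rewrite muln_gt0 => /andP[].
Qed.
Definition krylov (R : rcfType) n l (q : nat) (A : 'M[R[i]]_n) (Om : 'M[R[i]]_(n, l))
  : 'M[R[i]]_(n, q * l) :=
  \matrix_(i < n, j < q * l)
    ((A ^+ (j %/ l).+1 *m Om) i (Ordinal (krylov_idx_proof j))).

(* Main.v *)
(* With V = U^* Q, the relation K_q = Q R puts p(A) Omega in the range of Q for
   every polynomial p of degree <= q with p(0) = 0, and Omega_1 Omega_1^+ = I.
   Taking p(x) = x T_(q-1)(2 x / lambda_(k+1) - 1), the range of V contains that
   of (I; F) with F = p(Lambda_2) Omega_2 Omega_1^+ p(Lambda_1)^-1.  Compressing
   Lambda to the range of (I; F) and using det(I+M+N) <= det(I+M) det(I+N) for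
   positive semi-definite M, N gives
     det(I + Lambda_1) <= det(I + T) det(I + F Lambda_1 F')
   where F' is the adjoint of F, and F Lambda_1 F' <= eta Lambda_2 since
   |T_(q-1)| <= 1 on [-1, 1] and T_(q-1) increases on [1, +oo[. *)
Require Import Defs.
From HB Require Import structures.
From mathcomp Require Import all_boot all_order all_algebra.
From mathcomp Require Import all_classical all_reals.
From mathcomp Require Import exp.
From mathcomp Require Import complex.
From mathcomp Require Import ring lra.
Import Order.TTheory GRing.Theory Num.Theory.
Local Open Scope ring_scope.
Local Open Scope complex_scope.

Set Implicit Arguments.
Unset Strict Implicit.

(** Sylvester's identity: multiplying the block matrix (1, -X; Y, 1) by a unit triangular one on the
    right or on the left leaves a block triangular matrix with 1 + Y X or 1 + X Y on its
    diagonal. *)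
Lemma det_1addM_comm (K : comUnitRingType) m n (X : 'M[K]_(m, n)) (Y : 'M[K]_(n, m)) :
  \det (1%:M + X *m Y) = \det (1%:M + Y *m X).
Proof.
have E1 : block_mx 1%:M (- X) Y 1%:M *m block_mx 1%:M X 0 1%:M
        = block_mx 1%:M 0 Y (1%:M + Y *m X).
  by rewrite mulmx_block !mulmx1 !mulmx0 !mul1mx !addr0 subrr addrC.
have E2 : block_mx 1%:M X 0 1%:M *m block_mx 1%:M (- X) Y 1%:M
        = block_mx (1%:M + X *m Y) 0 Y 1%:M.
  by rewrite mulmx_block !mulmx1 !mul1mx !mul0mx !add0r addNr.
have := congr1 determinant E1; have := congr1 determinant E2.
by rewrite !det_mulmx !det_lblock !det_ublock !det1 !mul1r !mulr1 => <- <-.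
Qed.

(** * Positive semi-definite matrices: order and determinant inequalities *)

Section PositiveSemidefinite.
Local Open Scope sesquilinear_scope.
Variable C : numClosedFieldType.

Lemma adjmxM m n p (A : 'M[C]_(m, n)) (B : 'M[C]_(n, p)) :
  (A *m B)^t* = B^t* *m A^t*.
Proof. by rewrite trmx_mul map_mxM. Qed.

Lemma adjmxD m n (A B : 'M[C]_(m, n)) : (A + B)^t* = A^t* + B^t*.
Proof. by rewrite linearD map_mxD. Qed.

Lemma adjmxB m n (A B : 'M[C]_(m, n)) : (A - B)^t* = A^t* - B^t*.
Proof. by rewrite linearB map_mxB. Qed.

Lemma adjmx1 n : (1%:M : 'M[C]_n)^t* = 1%:M.
Proof. by rewrite trmx1 map_mx1. Qed.

Lemma adjmx_diag n (d : 'rV[C]_n) : (diag_mx d)^t* = diag_mx (map_mx Num.conj d).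
Proof. by rewrite tr_diag_mx map_diag_mx. Qed.

Lemma adjmx_diag_real n (d : 'rV[C]_n) : (forall i, d 0 i \is Num.real) ->
  (diag_mx d)^t* = diag_mx d.
Proof.
move=> dr; rewrite adjmx_diag; congr diag_mx; apply/rowP=> i.
by rewrite mxE conj_Creal.
Qed.

Lemma adjmx_col m1 m2 n (A : 'M[C]_(m1, n)) (B : 'M[C]_(m2, n)) :
  (col_mx A B)^t* = row_mx (A^t*) (B^t*).
Proof. by rewrite tr_col_mx map_row_mx. Qed.

Lemma adjmx_row m n1 n2 (A : 'M[C]_(m, n1)) (B : 'M[C]_(m, n2)) :
  (row_mx A B)^t* = col_mx (A^t*) (B^t*).
Proof. by rewrite tr_row_mx map_col_mx. Qed.

Lemma unitmx_adj n (L : 'M[C]_n) : (L^t* \in unitmx) = (L \in unitmx).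
Proof. by rewrite map_unitmx unitmx_tr. Qed.

Lemma adjmxV n (L : 'M[C]_n) : (invmx L)^t* = invmx (L^t*).
Proof. by rewrite trmx_inv map_invmx. Qed.

(* Positive semi-definiteness, in factored form. *)
Definition gram n (M : 'M[C]_n) := exists p (B : 'M[C]_(n, p)), M = B *m B^t*.

Lemma gram_self n p (B : 'M[C]_(n, p)) : gram (B *m B^t*).
Proof. by exists p, B. Qed.

Lemma gramD n (M N : 'M[C]_n) : gram M -> gram N -> gram (M + N).
Proof.
move=> [p [B ->]] [r [D ->]]; exists (p + r)%N, (row_mx B D).
by rewrite adjmx_row mul_row_col.
Qed.

Lemma gram_conj n p (X : 'M[C]_(p, n)) (M : 'M[C]_n) :
  gram M -> gram (X *m M *m X^t*).
Proof.
by move=> [r [B ->]]; exists r, (X *m B); rewrite adjmxM !mulmxA.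
Qed.

Lemma gramZ n (c : C) (M : 'M[C]_n) : 0 <= c -> gram M -> gram (c *: M).
Proof.
move=> c0 [p [B ->]]; exists p, (sqrtC c *: B).
have -> : (sqrtC c *: B)^t* = sqrtC c *: B^t*.
  by apply/matrixP => a b; rewrite !mxE rmorphM /= conj_Creal ?ger0_real ?sqrtC_ge0.
by rewrite -scalemxAl -scalemxAr scalerA -expr2 sqrtCK.
Qed.

Lemma gram_diag n (d : 'rV[C]_n) : (forall i, 0 <= d 0 i) -> gram (diag_mx d).
Proof.
move=> d0; exists n, (diag_mx (map_mx sqrtC d)).
rewrite adjmx_diag_real => [|i]; last by rewrite mxE ger0_real// sqrtC_ge0.
rewrite mulmx_diag; congr diag_mx; apply/rowP => i.
by rewrite !mxE -expr2 sqrtCK.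
Qed.

Lemma gram_herm n (M : 'M[C]_n) : gram M -> M^t* = M.
Proof. by move=> [p [B ->]]; rewrite adjmxM trmxCK. Qed.

Lemma gram_diag_ge0 n (M : 'M[C]_n) i : gram M -> 0 <= M i i.
Proof.
move=> [p [B ->]]; rewrite mxE; apply: sumr_ge0 => j _.
by rewrite !mxE mul_conjC_ge0.
Qed.

Lemma gram_spectral n (M : 'M[C]_n) : gram M ->
  exists (P : 'M[C]_n) (d : 'rV[C]_n),
    [/\ P \is unitarymx, forall i, 0 <= d 0 i & M = P^t* *m diag_mx d *m P].
Proof.
move=> gM; have hM : M \is hermsymmx.
  by apply/is_hermitianmxP; rewrite expr0 scale1r gram_herm.
have uP := spectral_unitarymx M.
have := hermitian_normalmx hM => /orthomx_spectralP.
set P := spectralmx M in uP *; set d := spectral_diag M; rewrite invmx_unitary// => eM.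
exists P, d; split=> // i.
(* The eigenvalue [d 0 i] is a diagonal entry of this congruent Gram matrix. *)
have : gram (P *m M *m P^t*) by apply: gram_conj.
have /unitarymxP PP := uP.
rewrite eM !mulmxA PP mul1mx -mulmxA PP mulmx1 => /(gram_diag_ge0 i).
by rewrite mxE eqxx.
Qed.

(** [L], built as P' sqrt(1 + d) from the spectral decomposition (a prime denotes the adjoint),
    stands in for a square root of 1 + M. It is invertible since every 1 + d_i is positive. *)
Lemma gram_1add_factor n (M : 'M[C]_n) : gram M ->
  exists L : 'M[C]_n, L \in unitmx /\ 1%:M + M = L *m L^t*.
Proof.
move=> /gram_spectral[P [d [uP d0 ->]]].
pose e := map_mx (fun x => sqrtC (1 + x)) d.
have uPt : P^t* *m P = 1%:M.
  by apply: mulmx1C; apply/unitarymxP.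
have d1 i : 0 < 1 + d 0 i by rewrite ltr_wpDr.
exists (P^t* *m diag_mx e); split.
  rewrite unitmx_mul unitmx_adj unitarymx_unit//=.
  rewrite unitmxE det_diag unitfE; apply/prodf_neq0 => i _.
  by rewrite mxE sqrtC_eq0 lt0r_neq0.
rewrite adjmxM trmxCK adjmx_diag_real => [|i]; last first.
  by rewrite mxE ger0_real// sqrtC_ge0 ltW.
rewrite -!mulmxA (mulmxA (diag_mx e)) mulmx_diag.
have -> : 1%:M = P^t* *m (1%:M *m P) by rewrite mul1mx.
rewrite -mulmxDr -mulmxDl -diag_const_mx -linearD /=.
congr (_ *m (_ *m _)); congr diag_mx; apply/rowP => i.
by rewrite !mxE -expr2 sqrtCK.
Qed.

(** By Sylvester's identity the unitary factors cancel, leaving the product of the 1 + d_i. *)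
Lemma det_1add_gram_ge1 n (M : 'M[C]_n) : gram M -> 1 <= \det (1%:M + M).
Proof.
move=> /gram_spectral[P [d [/unitarymxP uP d0 ->]]].
rewrite -mulmxA det_1addM_comm -mulmxA uP mulmx1 -diag_const_mx -linearD /= det_diag.
elim/big_rec: _ => // i x _ x1.
by rewrite mulr_ege1// !mxE lerDl.
Qed.

Lemma det_1add_gram_gt0 n (M : 'M[C]_n) : gram M -> 0 < \det (1%:M + M).
Proof. by move/det_1add_gram_ge1; apply: lt_le_trans. Qed.

(** With 1 + M = L L', the matrix 1 + N is congruent through L to the identity plus a Gram matrix,
    whose determinant is at least 1. *)
Lemma det_1add_gram_mono n (M N : 'M[C]_n) : gram M -> gram (N - M) ->
  \det (1%:M + M) <= \det (1%:M + N).
Proof.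
move=> gM gNM; have [L [uL eL]] := gram_1add_factor gM.
have -> : 1%:M + N = L *m (1%:M + invmx L *m (N - M) *m (invmx L)^t*) *m L^t*.
  rewrite mulmxDr mulmxDl mulmx1 -eL !mulmxA mulmxV// mul1mx.
  by rewrite -mulmxA adjmxV mulVmx ?unitmx_adj// mulmx1 -addrA subrKC.
rewrite !det_mulmx mulrAC -det_mulmx -eL ler_peMr//; first exact/ltW/det_1add_gram_gt0.
exact: det_1add_gram_ge1 (gram_conj _ gNM).
Qed.

(** With S = 1 + M, 1 - S^-1 = S^-1 (S^2 - S) S^-1 and S^2 - S = M + M^2. *)
Lemma gram_1sub_inv n (M : 'M[C]_n) : gram M -> gram (1%:M - invmx (1%:M + M)).
Proof.
move=> gM; have [L [uL eL]] := gram_1add_factor gM.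
set S := 1%:M + M in eL *.
have uS : S \in unitmx by rewrite eL unitmx_mul unitmx_adj uL.
have hS : S^t* = S by rewrite /S adjmxD adjmx1 gram_herm.
have -> : 1%:M - invmx S = invmx S *m (M + M *m M^t*) *m (invmx S)^t*.
  rewrite adjmxV hS (gram_herm gM).
  have -> : M + M *m M = S *m S - S.
    by rewrite -[X in _ - X]mulmx1 -mulmxBr /S [1%:M + M]addrC addrK mulmxDl mul1mx addrC.
  by rewrite mulmxBr mulKmx// mulVmx// mulmxBl mulmxV// mul1mx.
apply/gram_conj/gramD => //; exact: gram_self.
Qed.

(** With S = 1 + M and N = B B', the left side is det S det(1 + B' S^-1 B), and S^-1 <= 1. *)
Lemma det_1addD_le n (M N : 'M[C]_n) : gram M -> gram N ->
  \det (1%:M + M + N) <= \det (1%:M + M) * \det (1%:M + N).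
Proof.
move=> gM [p [B ->]]; have [L [uL eL]] := gram_1add_factor gM.
have uS : 1%:M + M \in unitmx by rewrite eL unitmx_mul unitmx_adj uL.
have gI := gram_1sub_inv gM; set S := 1%:M + M in eL uS gI *.
have -> : S + B *m B^t* = S *m (1%:M + invmx S *m B *m B^t*).
  by rewrite mulmxDr mulmx1 !mulmxA mulmxV// mul1mx.
rewrite det_mulmx ler_wpM2l//; first by rewrite ltW// det_1add_gram_gt0.
rewrite -mulmxA mulmxA det_1addM_comm (det_1addM_comm B).
have iS : invmx S = invmx (L^t*) *m invmx L.
  have uLt : L^t* \in unitmx by rewrite unitmx_adj.
  apply: (can_inj (mulKmx uS)); rewrite mulmxV// eL !mulmxA.
  by rewrite mulmxK// mulmxV.
apply: det_1add_gram_mono.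
  rewrite iS -adjmxV -!mulmxA.
  exists n, (B^t* *m (invmx L)^t*); by rewrite adjmxM !trmxCK !mulmxA.
have -> : B^t* *m B - B^t* *m (invmx S *m B) = B^t* *m (1%:M - invmx S) *m B^t*^t*.
  by rewrite trmxCK -mulmxA mulmxBl mul1mx mulmxBr.
exact: gram_conj.
Qed.


Lemma gram_sandwich_diag n (P : 'M[C]_n) (d : 'rV[C]_n) (c : C) :
  P \is unitarymx -> (forall i, d 0 i <= c) ->
  gram (c%:M - P^t* *m diag_mx d *m P).
Proof.
move=> uP dc.
have PtP : P^t* *m P = 1%:M by apply: mulmx1C; apply/unitarymxP.
have -> : c%:M - P^t* *m diag_mx d *m P
        = P^t* *m diag_mx (const_mx c - d) *m P^t*^t*.
  rewrite trmxCK linearB /= diag_const_mx mulmxBr mulmxBl.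
  by rewrite mul_mx_scalar -scalemxAl PtP scalemx1.
by apply/gram_conj/gram_diag => i; rewrite !mxE subr_ge0.
Qed.

(** The trace is the sum of the nonnegative eigenvalues, so it bounds each of them. *)
Lemma gram_trace_sub n (M : 'M[C]_n) : gram M -> gram ((\tr M)%:M - M).
Proof.
move=> /gram_spectral[P [d [uP d0 eM]]]; rewrite {2}eM.
apply: gram_sandwich_diag => // i.
rewrite eM mxtrace_mulC mulmxA (unitarymxP uP) mul1mx mxtrace_diag.
by rewrite (bigD1 i)//= lerDl sumr_ge0.
Qed.

(* A unit eigenvector v of G G^* for d satisfies |G^* v|^2 = d and
   |G G^* v|^2 = d^2, so the bound applied to G^* v reads d^2 <= c d. *)
Lemma gram_opnorm_sub m n (G : 'M[C]_(m, n)) (c : C) : 0 <= c ->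
  (forall x : 'cV[C]_n,
     ((G *m x)^t* *m (G *m x)) 0 0 <= c * (x^t* *m x) 0 0) ->
  gram (c%:M - G *m G^t*).
Proof.
move=> c0 Gc; have [P [d [uP d0 eG]]] := gram_spectral (gram_self G).
rewrite eG; apply: gram_sandwich_diag => // i.
have PP := unitarymxP uP.
pose v : 'cV[C]_m := P^t* *m delta_mx i 0.
have Gv : G *m G^t* *m v = d 0 i *: v.
  rewrite eG /v !mulmxA -(mulmxA _ P) PP mulmx1 -mulmxA mul_diag_mx.
  rewrite scalemxAr; congr (_ *m _); apply/matrixP => a b; rewrite !mxE.
  by case: eqP => [->|]; rewrite ?mulr0.
have vv : v^t* *m v = 1%:M.
  rewrite /v adjmxM trmxCK mulmxA -(mulmxA _ P) PP mulmx1 trmx_delta map_delta_mx.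
  by rewrite mul_delta_mx; apply/matrixP => a b; rewrite !ord1 !mxE eqxx.
have := Gc (G^t* *m v).
have -> : G *m (G^t* *m v) = d 0 i *: v by rewrite mulmxA.
have -> : (G^t* *m v)^t* *m (G^t* *m v) = d 0 i *: 1%:M.
  by rewrite adjmxM trmxCK -mulmxA (mulmxA G) Gv -scalemxAr vv.
have -> : (d 0 i *: v)^t* *m (d 0 i *: v) = (d 0 i ^+ 2) *: 1%:M.
  have -> : (d 0 i *: v)^t* = d 0 i *: v^t*.
    by apply/matrixP => a b; rewrite !mxE rmorphM/= (conj_Creal (ger0_real (d0 i))).
  by rewrite -scalemxAr -scalemxAl vv scalerA expr2.
rewrite !mxE eqxx !mulr1 expr2.
have := d0 i; rewrite le_eqVlt => /orP[/eqP <- //|dpos].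
by rewrite ler_pM2r.
Qed.

(** With T = B B', Sylvester's identity replaces Z' T Z by B' Z Z' B, which is at most B' B since 1
    - Z Z' is an orthogonal projection. *)
Lemma det_1add_compression n k (T : 'M[C]_n) (Z : 'M[C]_(n, k)) :
  gram T -> Z^t* *m Z = 1%:M ->
  \det (1%:M + Z^t* *m T *m Z) <= \det (1%:M + T).
Proof.
move=> [p [B ->]] ZZ.
have -> : Z^t* *m (B *m B^t*) *m Z = (Z^t* *m B) *m (B^t* *m Z) by rewrite !mulmxA.
rewrite det_1addM_comm (det_1addM_comm B).
have eZ : B^t* *m Z *m (Z^t* *m B) = (B^t* *m Z) *m (B^t* *m Z)^t*.
  by rewrite adjmxM trmxCK.
rewrite eZ; apply: det_1add_gram_mono; first exact: gram_self.
rewrite -eZ; pose D := 1%:M - Z *m Z^t*.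
have hD : D^t* = D by rewrite adjmxB adjmx1 adjmxM trmxCK.
have DD : D *m D = D.
  rewrite {1}/D mulmxBl mul1mx mulmxBr mulmx1 -mulmxA (mulmxA _ Z) ZZ mul1mx.
  by rewrite subrr subr0.
have -> : B^t* *m B - B^t* *m Z *m (Z^t* *m B) = (B^t* *m D) *m (B^t* *m D)^t*.
  rewrite adjmxM trmxCK hD [RHS]mulmxA -[X in _ = X *m _]mulmxA DD.
  by rewrite mulmxBr mulmxBl mulmx1 !mulmxA.
exact: gram_self.
Qed.

(* With S = 1 + F^* F, the compression of diag (d1, d2) to the column space of
   (1; F) dominates S^(-1/2) diag d1 S^(-1/2), and S^-1 + F^* F >= 1. *)
Lemma det_1add_graph_le k m p (d1 : 'rV[C]_k) (d2 : 'rV[C]_m)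
    (V : 'M[C]_(k + m, p)) (W : 'M[C]_(p, k)) (F : 'M[C]_(m, k)) :
  (forall i, 0 <= d1 0 i) -> (forall i, 0 <= d2 0 i) ->
  V^t* *m V = 1%:M -> V *m W = col_mx 1%:M F ->
  \det (1%:M + diag_mx d1) <=
  \det (1%:M + V^t* *m diag_mx (row_mx d1 d2) *m V)
  * \det (1%:M + F *m diag_mx d1 *m F^t*).
Proof.
move=> d10 d20 VV VW.
have gFF : gram (F^t* *m F) by exists m, (F^t*); rewrite trmxCK.
have [L [uL eL]] := gram_1add_factor gFF.
set S := 1%:M + F^t* *m F in eL.
have uLt : L^t* \in unitmx by rewrite unitmx_adj.
have uS : S \in unitmx by rewrite eL unitmx_mul uL.
have hS : S^t* = S by rewrite eL adjmxM trmxCK.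
have iS : invmx S = invmx (L^t*) *m invmx L.
  apply: (can_inj (mulKmx uS)); rewrite mulmxV// eL !mulmxA.
  by rewrite mulmxK// mulmxV.
have [r [H eH]] := gram_diag d10.
have gT : gram (V^t* *m diag_mx (row_mx d1 d2) *m V).
  rewrite -{2}(trmxCK V); apply/gram_conj/gram_diag => i.
  by rewrite mxE; case: splitP.
(* By Sylvester's identity, [1 + M] and [1 + N] have the determinants of 1 + L^-1 D1 (L^-1)' and 1 +
   F D1 F', where D1 = H H'. *)
pose M := H^t* *m invmx S *m H.
pose N := H^t* *m (F^t* *m F) *m H.
have gM : gram M.
  exists k, (H^t* *m invmx (L^t*)).
  by rewrite /M adjmxM trmxCK adjmxV trmxCK iS !mulmxA.
have gN : gram N by rewrite /N -{2}(trmxCK H); apply: gram_conj.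
apply: (@le_trans _ _ (\det (1%:M + M) * \det (1%:M + N))).
  apply: le_trans (det_1addD_le gM gN).
  rewrite eH det_1addM_comm -addrA; apply: det_1add_gram_mono.
    by exists k, (H^t*); rewrite trmxCK.
  (* The middle factor is S^-1 + S - 2 = (S - 1) S^-1 (S - 1), hence positive semi-definite. *)
  have -> : M + N - H^t* *m H
      = (H^t* *m (S - 1%:M) *m invmx (L^t*)) *m (H^t* *m (S - 1%:M) *m invmx (L^t*))^t*.
    rewrite !adjmxM trmxCK adjmxV trmxCK adjmxB adjmx1 hS.
    have -> : M + N - H^t* *m H = H^t* *m (invmx S + F^t* *m F - 1%:M) *m H.
      by rewrite !(mulmxBr, mulmxBl, mulmxDr, mulmxDl) mulmx1.
    have -> : F^t* *m F = S - 1%:M by rewrite /S addrC addKr.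
    have -> : invmx S + (S - 1%:M) - 1%:M = (S - 1%:M) *m invmx S *m (S - 1%:M).
      rewrite mulmxBl mul1mx mulmxV// mulmxBl mul1mx mulmxBr mulVmx// mulmx1.
      by rewrite opprB [RHS]addrC addrAC.
    by rewrite iS !mulmxA.
  exact: gram_self.
have -> : \det (1%:M + N) = \det (1%:M + F *m diag_mx d1 *m F^t*).
  have -> : N = (H^t* *m F^t*) *m (F *m H) by rewrite /N !mulmxA.
  by rewrite det_1addM_comm eH !mulmxA.
apply: ler_wpM2r.
  by apply/ltW/det_1add_gram_gt0/gram_conj/gram_diag.
(* Orthonormalizes the columns of V W = (1; F), whose Gram matrix is S = L L'. *)
pose Z := W *m invmx (L^t*).
have XX : (col_mx 1%:M F)^t* *m col_mx 1%:M F = S.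
  by rewrite adjmx_col mul_row_col adjmx1 mul1mx.
have ZZ : Z^t* *m Z = 1%:M.
  rewrite adjmxM adjmxV trmxCK !mulmxA.
  have -> : invmx L *m W^t* *m W = invmx L *m S.
    by rewrite -XX -VW adjmxM !mulmxA -(mulmxA _ (V^t*)) VV mulmx1.
  by rewrite eL mulKmx// mulmxV.
apply: le_trans (det_1add_compression gT ZZ).
have -> : Z^t* *m (V^t* *m diag_mx (row_mx d1 d2) *m V) *m Z
    = invmx L *m (diag_mx d1 + F^t* *m diag_mx d2 *m F) *m (invmx L)^t*.
  have -> : diag_mx d1 + F^t* *m diag_mx d2 *m F =
      (col_mx 1%:M F)^t* *m diag_mx (row_mx d1 d2) *m col_mx 1%:M F.
    rewrite diag_mx_row adjmx_col adjmx1 mul_row_block mul_row_col.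
    by rewrite !mulmx0 addr0 add0r mul1mx mulmx1.
  by rewrite -VW /Z !adjmxM !adjmxV trmxCK !mulmxA.
have -> : \det (1%:M + M) = \det (1%:M + invmx L *m diag_mx d1 *m (invmx L)^t*).
  have -> : M = (H^t* *m invmx (L^t*)) *m (invmx L *m H) by rewrite /M iS !mulmxA.
  by rewrite det_1addM_comm eH adjmxV !mulmxA.
(* Only the nonnegative term F' D2 F is dropped. *)
apply: det_1add_gram_mono; first by apply/gram_conj/gram_diag.
rewrite -mulmxBl -mulmxBr addrC addKr; apply: gram_conj.
by rewrite -{2}(trmxCK F); apply/gram_conj/gram_diag.
Qed.

(** Two successive bounds: E G D G' E' <= c E G G' E' <= c t E E'. *)
Lemma gram_weighted_sub m k (E : 'M[C]_m) (G : 'M[C]_(m, k)) (D : 'M[C]_k) (c t : C) :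
  0 <= c -> gram (c%:M - D) -> gram (t%:M - G *m G^t*) ->
  gram ((c * t) *: (E *m E^t*) - (E *m G) *m D *m (E *m G)^t*).
Proof.
move=> c0 gD gG.
have -> : (c * t) *: (E *m E^t*) - (E *m G) *m D *m (E *m G)^t*
    = c *: (E *m (t%:M - G *m G^t*) *m E^t*) + (E *m G) *m (c%:M - D) *m (E *m G)^t*.
  rewrite !(mulmxBr, mulmxBl) !mul_mx_scalar -!scalemxAl scalerBr scalerA addrA.
  by rewrite adjmxM !mulmxA subrK.
by apply: gramD; [apply/gramZ => //; apply: gram_conj | apply: gram_conj].
Qed.

End PositiveSemidefinite.

(** * Chebyshev polynomials: degree, boundedness on [-1, 1], growth beyond 1 *)

Section Chebyshev.
Lemma chebTSS (K : pzRingType) n (x : K) :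
  chebT n.+2 x = 2 * x * chebT n.+1 x - chebT n x.
Proof. by []. Qed.

(** Applied to polynomial evaluation and to the embedding of R into R[i], it lets [chebT] serve both
    as a polynomial and as a real function. *)
Lemma rmorph_chebT (K L : pzRingType) (f : {rmorphism K -> L}) n x :
  f (chebT n x) = chebT n (f x).
Proof.
suff : f (chebT n x) = chebT n (f x) /\ f (chebT n.+1 x) = chebT n.+1 (f x) by case.
elim: n => [|n [IH1 IH2]]; first by rewrite /chebT /= rmorph1.
by split=> //; rewrite !chebTSS rmorphB !rmorphM rmorph_nat IH1 IH2.
Qed.

Lemma size_chebT (K : nzRingType) n (p : {poly K}) :
  (size p <= 2)%N -> (size (chebT n p) <= n.+1)%N.
Proof.
move=> sp.
suff : (size (chebT n p) <= n.+1)%N /\ (size (chebT n.+1 p) <= n.+2)%N by case.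
elim: n => [|n [IH1 IH2]]; first by rewrite /chebT /= size_poly1.
split=> //; rewrite chebTSS (leq_trans (size_polyD _ _))// size_polyN geq_max.
apply/andP; split; last exact: leq_trans IH1 (leqW (leqnSn _)).
rewrite -mulrA mulr_natl -scaler_nat.
apply: leq_trans (size_scale_leq _ _) _.
apply: leq_trans (size_polyMleq _ _) _.
by rewrite -subn1 leq_subLR (leq_add sp IH2).
Qed.

Variable R : realFieldType.

(** The form a^2 + b^2 - 2 x a b is invariant under the recurrence step (a, b) -> (b, 2 x b - a);
    for x = cos t its value is sin^2 t. *)
Lemma chebT_quadratic n (x : R) :
  chebT n x ^+ 2 + chebT n.+1 x ^+ 2 - 2 * x * chebT n x * chebT n.+1 x
  = 1 - x ^+ 2.
Proof.
elim: n => [|n IH]; first by rewrite /chebT /=; ring.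
by rewrite -IH chebTSS; ring.
Qed.

(** For consecutive values a, b the invariant reads (a - x b)^2 = (1 - x^2) (1 - b^2), so b^2 <= 1
    when x^2 < 1. When x^2 = 1 it forces b = x a, and induction applies. *)
Lemma chebT_sqr_le1 n (x : R) : -1 <= x -> x <= 1 -> chebT n x ^+ 2 <= 1.
Proof.
move=> x1 x2; have x21 : x ^+ 2 <= 1 by nra.
elim: n => [|n IH]; first by rewrite /chebT /= expr1n.
have := chebT_quadratic n x.
set a := chebT n x in IH *; set b := chebT n.+1 x => E.
move: x21; rewrite le_eqVlt => /orP[/eqP x21|x21].
  have : (b - x * a) ^+ 2
      = (a ^+ 2 + b ^+ 2 - 2 * x * a * b) + (x ^+ 2 - 1) * a ^+ 2 by ring.
  rewrite E x21 !subrr mul0r addr0.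
  move/eqP; rewrite sqrf_eq0 subr_eq0 => /eqP ->.
  by rewrite exprMn x21 mul1r.
have : (a - x * b) ^+ 2 + (1 - x ^+ 2) * (b ^+ 2 - 1)
    = (a ^+ 2 + b ^+ 2 - 2 * x * a * b) - (1 - x ^+ 2) by ring.
rewrite E subrr.
have := sqr_ge0 (a - x * b); nra.
Qed.

Lemma chebT_ge1_mono n (x y : R) : 1 <= y -> y <= x ->
  1 <= chebT n y <= chebT n x.
Proof.
move=> y1 yx.
(* The increments are carried along: the next one is the present one plus 2 (x - 1) [chebT n.+1 x],
   and both terms grow with x. *)
suff : 1 <= chebT n y <= chebT n x /\
  0 <= chebT n.+1 y - chebT n y <= chebT n.+1 x - chebT n x by case.
elim: n => [|n [/andP[IH1 IH2] /andP[IH3 IH4]]]; first by rewrite /chebT /=; lra.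
rewrite !chebTSS; move: IH1 IH2 IH3 IH4.
set a := chebT n x; set b := chebT n.+1 x.
set c := chebT n y; set d := chebT n.+1 y => *.
split; apply/andP; split; try lra; last first; nra.
Qed.

End Chebyshev.

(** * Polynomials in A applied to Omega lie in the Krylov range *)

Section Krylov.
Variables (R : rcfType) (n l q : nat) (A : 'M[R[i]]_n) (Om : 'M[R[i]]_(n, l)).

Lemma krylov_pow p : (p < q)%N ->
  exists Y : 'M[R[i]]_(q * l, l), krylov q A Om *m Y = A ^+ p.+1 *m Om.
Proof.
(* The witness selects columns p l to p l + l - 1, which form the block A^(p+1) Om. *)
move=> pq; exists (\matrix_(j, c) ((j : nat) == p * l + c)%N%:R).
apply/matrixP => a c; rewrite mxE.
have jlt : (p * l + c < q * l)%N.
  by rewrite (leq_trans (_ : _ < p.+1 * l)%N) ?leq_mul2r ?pq ?orbT//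
    mulSn addnC ltn_add2r.
rewrite (bigD1 (Ordinal jlt))//= big1 => [|j jN]; last first.
  rewrite !mxE; case: eqP => [E|_]; last by rewrite mulr0.
  by case/eqP: jN; apply: val_inj.
rewrite addr0 !mxE eqxx mulr1.
have l0 : (0 < l)%N by apply: leq_ltn_trans (ltn_ord c).
apply: eq_bigr => j _; rewrite /= divnMDl// divn_small// addn0.
congr (_ * Om _ _); apply: val_inj => /=.
by rewrite modnMDl modn_small.
Qed.

Lemma krylov_sum (a : nat -> R[i]) r : (r <= q)%N ->
  exists Y : 'M[R[i]]_(q * l, l),
    krylov q A Om *m Y = (\sum_(p < r) a p *: A ^+ p.+1) *m Om.
Proof.
elim: r => [|r IH] rq; first by exists 0; rewrite big_ord0 mulmx0 mul0mx.
have [Y1 E1] := IH (ltnW rq); have [Y2 E2] := krylov_pow rq.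
exists (Y1 + a r *: Y2).
by rewrite mulmxDr E1 -scalemxAr E2 big_ord_recr /= mulmxDl scalemxAl.
Qed.

(** Since f has degree below q and the blocks begin at A, the coefficients of f combine them into A
    f(A) Om; in the eigenbasis this is the diagonal of x f(x). *)
Lemma krylov_horner (U : 'M[R[i]]_n) (d : 'rV[R[i]]_n) (f : {poly R[i]}) :
  ctrmx U *m U = 1%:M -> A = U *m diag_mx d *m ctrmx U -> (size f <= q)%N ->
  exists Y : 'M[R[i]]_(q * l, l),
    ctrmx U *m krylov q A Om *m Y =
    diag_mx (\row_j (d 0 j * f.[d 0 j])) *m (ctrmx U *m Om).
Proof.
move=> UU eA sf; have [Y EY] := krylov_sum (fun p => f`_p) (leqnn q).
exists Y; rewrite -mulmxA EY mulmxA mulmx_sumr mulmxA; congr (_ *m _).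
have pw p : ctrmx U *m A ^+ p = diag_mx (\row_j (d 0 j ^+ p)) *m ctrmx U.
  elim: p => [|p IH].
    rewrite expr0 mulmx1 -[LHS]mul1mx; congr (_ *m _).
    by rewrite -diag_const_mx; congr diag_mx; apply/rowP=> j; rewrite !mxE.
  rewrite exprSr -mulmxE mulmxA IH eA !mulmxA -(mulmxA _ _ U) UU mulmx1 mulmx_diag.
  by congr (diag_mx _ *m _); apply/rowP=> j; rewrite !mxE exprSr.
under eq_bigr do rewrite -scalemxAr pw scalemxAl.
rewrite -mulmx_suml; congr (_ *m _).
apply/matrixP => i j; rewrite summxE !mxE.
rewrite (horner_coef_wide _ sf) mulr_sumr -sumrMnl.
apply: eq_bigr => p _; rewrite !mxE.
by rewrite mulrnAr exprS mulrCA.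
Qed.
End Krylov.

(** * The spectral norm as an operator bound, and logarithms of positive determinants *)

Section SpectralNorm.
Variable R : realType.
Local Open Scope sesquilinear_scope.

Lemma ctrmxE m n (M : 'M[R[i]]_(m, n)) : ctrmx M = M^t*.
Proof. by []. Qed.

Lemma vnorm2_ge0 n (x : 'cV[R[i]]_n) : 0 <= vnorm2 x.
Proof. by apply: sumr_ge0 => j _; rewrite addr_ge0 ?sqr_ge0. Qed.

Lemma vnorm2E n (x : 'cV[R[i]]_n) : (x^t* *m x) 0 0 = (vnorm2 x)%:C.
Proof.
rewrite mxE rmorph_sum; apply: eq_bigr => j _.
by rewrite !mxE mulrC -sqr_normc -add_Re2_Im2.
Qed.

Lemma vnorm2_eq0 n (x : 'cV[R[i]]_n) : (vnorm2 x == 0) = (x == 0).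
Proof.
rewrite psumr_eq0 => [|j _]; last by rewrite addr_ge0 ?sqr_ge0.
apply/allP/eqP => [x0|-> j _]; last by rewrite !mxE /= expr0n addr0.
apply/colP => j; have := x0 j (mem_index_enum _).
rewrite !mxE paddr_eq0 ?sqr_ge0// !sqrf_eq0 => /andP[/eqP a /eqP b].
by apply/eqP; rewrite eq_complex a b !eqxx.
Qed.

(** The trace of G' G serves as bound; it makes the set of quotients under the supremum in
    [spec_norm] bounded. *)
Lemma vnorm2_mulmx_bounded m n (G : 'M[R[i]]_(m, n)) :
  exists2 b : R, 0 <= b & forall x : 'cV_n, vnorm2 (G *m x) <= b * vnorm2 x.
Proof.
have gG : gram (G^t* *m G) by exists m, (G^t*); rewrite trmxCK.
have tr0 : 0 <= \tr (G^t* *m G) by apply: sumr_ge0 => j _; apply: gram_diag_ge0.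
exists (complex.Re (\tr (G^t* *m G))).
  by move: tr0; rewrite lecE => /andP[].
move=> x; rewrite -lecR rmorphM /= (RRe_real (ger0_real tr0)) -!vnorm2E.
have := gram_diag_ge0 0 (gram_conj (x^t*) (gram_trace_sub gG)).
rewrite trmxCK mulmxBr mulmxBl mxE [X in _ + X]mxE subr_ge0.
by rewrite mul_mx_scalar -scalemxAl [X in _ <= X]mxE adjmxM !mulmxA.
Qed.

Lemma vnorm2_mulmx_le m n (G : 'M[R[i]]_(m, n)) (x : 'cV_n) :
  vnorm2 (G *m x) <= spec_norm G ^+ 2 * vnorm2 x.
Proof.
have [->|x0] := eqVneq x 0.
  have z p : vnorm2 (0 : 'cV[R[i]]_p) = 0 by apply/eqP; rewrite vnorm2_eq0.
  by rewrite mulmx0 !z mulr0.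
have nx : 0 < vnorm2 x by rewrite lt_neqAle vnorm2_ge0 eq_sym vnorm2_eq0 x0.
have [b b0 bG] := vnorm2_mulmx_bounded G.
have le_s : Num.sqrt (vnorm2 (G *m x)) / Num.sqrt (vnorm2 x) <= spec_norm G.
  apply: ub_le_sup; last by exists x.
  exists (Num.sqrt b) => _ [y y0 <-].
  have ny : 0 < vnorm2 y by rewrite lt_neqAle vnorm2_ge0 eq_sym vnorm2_eq0 y0.
  by rewrite ler_pdivrMr ?sqrtr_gt0// -sqrtrM// ler_wsqrtr.
rewrite -ler_pdivrMr// -(sqr_sqrtr (vnorm2_ge0 (G *m x))) -(sqr_sqrtr (vnorm2_ge0 x)).
rewrite -expr_div_n lerXn2r ?nnegrE ?divr_ge0 ?sqrtr_ge0//.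
by apply: le_trans le_s; rewrite divr_ge0 ?sqrtr_ge0.
Qed.

Lemma gram_spec_norm_sub m n (G : 'M[R[i]]_(m, n)) :
  gram ((spec_norm G ^+ 2)%:C%:M - G *m G^t*).
Proof.
apply: gram_opnorm_sub => [|x]; first by rewrite ler0c sqr_ge0.
by rewrite !vnorm2E -rmorphM lecR vnorm2_mulmx_le.
Qed.

(** A positive element of R[i] is real, so taking real parts is multiplicative here. *)
Lemma ln_Re_mul (a b : R[i]) : 0 < a -> 0 < b ->
  ln (complex.Re (a * b)) = ln (complex.Re a) + ln (complex.Re b).
Proof.
move=> a0 b0.
rewrite -(RRe_real (gtr0_real a0)) -(RRe_real (gtr0_real b0)) -rmorphM /=.
by rewrite lnM// posrE -ltcR RRe_real ?gtr0_real.
Qed.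

Lemma ler_ln_Re (a b : R[i]) : 0 < a -> a <= b ->
  ln (complex.Re a) <= ln (complex.Re b).
Proof.
move=> a0 ab; have b0 := lt_le_trans a0 ab.
move: a0 ab b0; rewrite !lecE !ltcE /= => /andP[_ ?] /andP[_ ?] /andP[_ ?].
by rewrite ler_ln.
Qed.
End SpectralNorm.

(** * Chebyshev filtering and the bound for the leading eigenvalues *)

Section KrylovBound.
Local Open Scope sesquilinear_scope.
Variables (R : realType) (k m l q : nat).
Variables (A U : 'M[R[i]]_(k + m)) (a : 'I_k -> R) (b : 'I_m -> R).
Variables (Om : 'M[R[i]]_(k + m, l)) (Om1p : 'M[R[i]]_(l, k)).
Variables (Q : 'M[R[i]]_(k + m, q * l)) (Rq : 'M[R[i]]_(q * l)) (mu nu : R).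

Let D1 : 'M[R[i]]_k := diag_mx (\row_i (a i)%:C).
Let D2 : 'M[R[i]]_m := diag_mx (\row_i (b i)%:C).
Let G := (rsubmx U)^t* *m Om *m Om1p.
Let eta := mu / nu * (chebT q.-1 ((2 * nu - mu) / mu))^-2 * spec_norm G ^+ 2.

(** Here [nu] and [mu] play the roles of lambda_k and lambda_(k+1), and [G] that of Omega_2
    Omega_1^+. The graph inequality leaves F D1 F' <= eta D2 to be shown. *)
Lemma det_1add_head_le :
  U^t* *m U = 1%:M ->
  A = U *m diag_mx (row_mx (\row_i (a i)%:C) (\row_i (b i)%:C)) *m U^t* ->
  0 < mu -> mu < nu -> (forall i, nu <= a i) -> (forall i, 0 <= b i <= mu) ->
  (0 < q)%N -> (lsubmx U)^t* *m Om *m Om1p = 1%:M ->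
  Q^t* *m Q = 1%:M -> krylov q A Om = Q *m Rq ->
  \det (1%:M + D1)
  <= \det (1%:M + Q^t* *m A *m Q) * \det (1%:M + eta%:C *: D2).
Proof.
move=> UU eA mu0 munu nua bmu q0 Om1 QQ eK.
have UU' : U *m U^t* = 1%:M by apply: mulmx1C.
(* The affine map sends [0, mu] onto [-1, 1], and nu to the argument appearing in [eta]. *)
pose psi x := chebT q.-1 (2 / mu * x - 1).
have psinu : psi nu = chebT q.-1 ((2 * nu - mu) / mu).
  by rewrite /psi; congr chebT; field; apply: lt0r_neq0.
have psi_head x : nu <= x -> 1 <= psi nu <= psi x.
  move=> nux; apply: chebT_ge1_mono.
    have : 1 <= nu / mu by rewrite ler_pdivlMr// mul1r ltW.
    by rewrite -mulrA (mulrC mu^-1); lra.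
  by rewrite lerD2r ler_pM2l// divr_gt0.
have psi_tail x : 0 <= x <= mu -> psi x ^+ 2 <= 1.
  move=> /andP[x0 xmu]; apply: chebT_sqr_le1.
    by rewrite lerDr mulr_ge0// divr_ge0// ltW.
  have : x / mu <= 1 by rewrite ler_pdivrMr// mul1r.
  by rewrite -mulrA (mulrC mu^-1); lra.
pose f : {poly R[i]} := chebT q.-1 ((2 / mu)%:C *: 'X - 1).
have fE x : f.[x%:C] = (psi x)%:C.
  rewrite -/(horner_eval _ f) /f /psi !rmorph_chebT; congr chebT.
  by rewrite /= /horner_eval !hornerE [RHS]rmorphB [X in _ = X - _]rmorphM rmorph1.
have sf : (size f <= q)%N.
  rewrite -(prednK q0); apply: size_chebT.
  rewrite (leq_trans (size_polyD _ _))// geq_max size_polyN size_poly1 andbT.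
  by rewrite (leq_trans (size_scale_leq _ _))// size_polyX.
set d := row_mx _ _ in eA.
have [Y] := krylov_horner Om UU eA sf.
(* Values of x psi(x) on the two parts of the spectrum; psi >= 1 on the head makes [E1] invertible,
   with inverse [E1']. *)
pose e1 i := a i * psi (a i); pose e2 i := b i * psi (b i).
pose E1 : 'M[R[i]]_k := diag_mx (\row_i (e1 i)%:C).
pose E2 : 'M[R[i]]_m := diag_mx (\row_i (e2 i)%:C).
pose E1' : 'M[R[i]]_k := diag_mx (\row_i (e1 i)^-1%:C).
have -> : diag_mx (\row_j (d 0 j * f.[d 0 j])) = block_mx E1 0 0 E2.
  rewrite /E1 /E2 -diag_mx_row; congr diag_mx; apply/rowP => j; rewrite !mxE.
  by case: splitP => i _; rewrite !mxE fE -rmorphM.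
rewrite ctrmxE; have -> : U^t* *m Om = col_mx ((lsubmx U)^t* *m Om) ((rsubmx U)^t* *m Om).
  by rewrite -{1}(hsubmxK U) adjmx_row mul_col_mx.
rewrite eK => EY.
pose V := U^t* *m Q; pose F := E2 *m G *m E1'.
have a0 i : 0 < a i by apply: lt_le_trans (nua i); apply: lt_trans munu.
have psia i : 1 <= psi (a i).
  by have /andP[p1 p2] := psi_head _ (nua i); apply: le_trans p2.
have e10 i : 0 < e1 i by rewrite mulr_gt0// (lt_le_trans ltr01).
have EE : E1 *m E1' = 1%:M.
  rewrite mulmx_diag -diag_const_mx; congr diag_mx; apply/rowP => i.
  by rewrite !mxE -rmorphM divff ?lt0r_neq0.
(* The Krylov combination is (E1 Omega_1; E2 Omega_2); multiplying on the right by [Om1p] and [E1']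
   turns its top block into 1. *)
have VW : V *m (Rq *m Y *m Om1p *m E1') = col_mx 1%:M F.
  have -> : V *m (Rq *m Y *m Om1p *m E1') = U^t* *m (Q *m Rq) *m Y *m Om1p *m E1'.
    by rewrite /V !mulmxA.
  rewrite EY mul_block_col !mul0mx addr0 add0r !mul_col_mx -!(mulmxA E1) Om1.
  by rewrite mul1mx EE /F /G !mulmxA.
have VV : V^t* *m V = 1%:M.
  by rewrite /V adjmxM trmxCK !mulmxA -(mulmxA _ U) UU' mulmx1.
have eT : Q^t* *m A *m Q = V^t* *m diag_mx d *m V.
  by rewrite eA /V adjmxM trmxCK !mulmxA.
have d10 i : 0 <= (\row_i (a i)%:C : 'rV[R[i]]_k) 0 i by rewrite mxE ler0c ltW.
have d20 i : 0 <= (\row_i (b i)%:C : 'rV[R[i]]_m) 0 i.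
  by rewrite mxE ler0c; have /andP[] := bmu i.
rewrite eT; apply: le_trans (det_1add_graph_le d10 d20 VV VW) _.
apply: ler_wpM2l.
  apply/ltW/det_1add_gram_gt0; rewrite -{2}(trmxCK V); apply/gram_conj/gram_diag => i.
  by rewrite mxE; case: splitP => j _.
have gF : gram (F *m D1 *m F^t*) by apply/gram_conj/gram_diag.
apply: det_1add_gram_mono => //.
(* [c] bounds the entries 1 / (a psi(a)^2) of E1^-1 D1 E1^-1, because a >= nu and psi(a) >=
   psi(nu). *)
pose c := (nu * psi nu ^+ 2)^-1; pose t := spec_norm G ^+ 2.
have nu0 : 0 < nu by apply: lt_trans munu.
have psinu1 : 1 <= psi nu by have /andP[] := psi_head nu (lexx _).
have c0 : 0 <= c by rewrite invr_ge0 mulr_ge0 ?sqr_ge0// ltW.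
have t0 : 0 <= t by rewrite sqr_ge0.
have etaE : eta = mu * c * t.
  by rewrite /eta -psinu /t /c [(nu * _)^-1]invfM (mulrA mu).
have hE1 : E1'^t* = E1'.
  by apply: adjmx_diag_real => i; rewrite mxE complex_real.
have hE2 : E2^t* = E2.
  by apply: adjmx_diag_real => i; rewrite mxE complex_real.
have gD : gram (c%:C%:M - E1' *m D1 *m E1').
  rewrite !mulmx_diag -diag_const_mx -linearB; apply: gram_diag => i.
  rewrite !mxE -!rmorphM -rmorphB ler0c subr_ge0.
  have -> : (e1 i)^-1 * a i * (e1 i)^-1 = (a i * psi (a i) ^+ 2)^-1.
    have ai0 : a i != 0 by rewrite lt0r_neq0.
    have psii0 : psi (a i) != 0 by rewrite lt0r_neq0// (lt_le_trans ltr01).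
    by rewrite /e1; field; rewrite ai0 psii0.
  have psi2_gt0 (x y : R) : 0 < x -> 1 <= y -> 0 < x * y ^+ 2.
    by move=> x0 y1; rewrite mulr_gt0// exprn_gt0// (lt_le_trans ltr01).
  rewrite lef_pV2 ?posrE ?psi2_gt0//.
  have /andP[p1 p2] := psi_head _ (nua i).
  apply: ler_pM; rewrite ?sqr_ge0//; first exact: ltW.
  by rewrite lerXn2r// nnegrE (le_trans ler01).
have c0C : 0 <= c%:C by rewrite ler0c.
have gFb := gram_weighted_sub E2 c0C gD (gram_spec_norm_sub G).
(* Both sides are compared with c t E2 E2'. The second difference is [gFb]; the first is diagonal,
   and nonnegative because (b psi(b))^2 <= mu b. *)
have -> : eta%:C *: D2 - F *m D1 *m F^t*
   = (eta%:C *: D2 - (c%:C * t%:C) *: (E2 *m E2^t*)) +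
     ((c%:C * t%:C) *: (E2 *m E2^t*)
      - E2 *m G *m (E1' *m D1 *m E1') *m (E2 *m G)^t*).
  rewrite addrA subrK; congr (_ - _).
  by rewrite /F adjmxM hE1 !mulmxA.
apply: gramD gFb.
rewrite hE2 mulmx_diag -!linearZ -linearB; apply: gram_diag => i.
rewrite !mxE -!rmorphM -rmorphB ler0c subr_ge0 etaE.
have := bmu i; have := psi_tail _ (bmu i); rewrite /e2.
set x := psi _ ^+ 2 => x1 /andP[b0 b1].
have -> : c * t * (b i * psi (b i) * (b i * psi (b i))) = c * t * (b i * (b i * x)).
  by rewrite /x; ring.
rewrite -(mulrA mu) (mulrC mu) -(mulrA (c * t)) ler_wpM2l ?(mulr_ge0 c0)//.
rewrite (mulrC mu) ler_wpM2l//; apply: le_trans b1.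
by rewrite ler_piMr.
Qed.
End KrylovBound.

(** * Assembly of the two log-determinant inequalities *)

Unset Implicit Arguments.
Set Strict Implicit.

(* n = k + m; eigenvalues are lam 1, ..., lam n (1-indexed, as in the paper) *)
Theorem theorem6 (R : realType) (k m l q : nat)
    (A : 'M[R[i]]_(k + m)) (U : 'M[R[i]]_(k + m)) (lam : nat -> R)
    (Om : 'M[R[i]]_(k + m, l)) (Om1p : 'M[R[i]]_(l, k))
    (Q : 'M[R[i]]_(k + m, q * l)) (Rq : 'M[R[i]]_(q * l)) :
  psd A ->
  ctrmx U *m U = 1%:M ->
  A = U *m diag_mx (\row_(i < k + m) (lam i.+1)%:C) *m ctrmx U ->
  (forall i j : nat, (1 <= i)%N -> (i <= j)%N -> (j <= k + m)%N -> lam j <= lam i) ->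
  (1 <= k)%N -> (1 <= m)%N ->
  lam (k.+1) < lam k -> 0 < lam (k.+1) ->
  (1 <= q)%N -> (k <= l)%N -> (l <= k + m)%N ->
  \rank (ctrmx (lsubmx U) *m Om) = k ->
  \rank (krylov q A Om) = (q * l)%N ->
  mp_inverse (ctrmx (lsubmx U) *m Om) Om1p ->
  orthonormal_cols Q -> is_trig_mx Rq^T -> krylov q A Om = Q *m Rq ->
  let T := ctrmx Q *m A *m Q in
  let Lam2 := diag_mx (\row_(i < m) (lam (k + i.+1)%N)%:C) in
  let eta := lam k.+1 / lam k
             * (chebT q.-1 ((2 * lam k - lam k.+1) / lam k.+1))^-2
             * spec_norm (ctrmx (rsubmx U) *m Om *m Om1p) ^+ 2 in
  0 <= logdet (1%:M + A) - logdet (1%:M + T) /\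
  logdet (1%:M + A) - logdet (1%:M + T)
    <= logdet (1%:M + eta%:C *: Lam2) + logdet (1%:M + Lam2).
Proof.
move=> psdA UU eA lam_dec k0 m0 lamk lamk1 q0 kl lkm rk1 _ [XYX _ _ _] QQ _ eK T Lam2 eta.
pose d1 : 'rV[R[i]]_k := \row_i (lam i.+1)%:C.
pose d2 : 'rV[R[i]]_m := \row_i (lam (k + i.+1)%N)%:C.
have ed : \row_(i < k + m) (lam i.+1)%:C = row_mx d1 d2.
  apply/rowP => j; rewrite !mxE.
  by case: splitP => i ->; rewrite mxE ?addnS.
rewrite ed in eA.
have d0 j : 0 <= row_mx d1 d2 0 j.
  (* The quadratic form at the j-th eigenvector is the j-th eigenvalue. *)
  have [_ /(_ (U *m delta_mx j 0))] := psdA.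
  have -> : ctrmx (U *m delta_mx j 0) *m A *m (U *m delta_mx j 0)
      = col j (row j (diag_mx (row_mx d1 d2))).
    rewrite colE rowE ctrmxE adjmxM trmx_delta map_delta_mx eA !mulmxA.
    by rewrite -(mulmxA _ (ctrmx U) U) UU mulmx1 -(mulmxA _ (ctrmx U) U) UU mulmx1.
  by rewrite !mxE eqxx mulr1n; case: splitP => i _; rewrite !mxE ler0c.
have gD : gram (diag_mx (row_mx d1 d2)) by apply: gram_diag.
have gA : gram A by rewrite eA; apply: gram_conj.
have gT : gram T by rewrite /T -{2}(trmxCK Q); apply: gram_conj.
have bmu (i : 'I_m) : 0 <= lam (k + i.+1)%N <= lam k.+1.
  have := d0 (rshift k i); rewrite row_mxEr mxE ler0c => -> /=.
  by apply: lam_dec; rewrite // addnS ?ltnS ?leq_addr// -addnS leq_add2l.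
have eta0 : 0 <= eta.
  rewrite /eta mulr_ge0 ?sqr_ge0// mulr_ge0 ?invr_ge0 ?sqr_ge0//.
  by rewrite divr_ge0 ?ltW// (lt_trans lamk1).
have Om1 : ctrmx (lsubmx U) *m Om *m Om1p = 1%:M.
  (* Full row rank gives X Z = 1 for X = [ctrmx (lsubmx U) *m Om], so X X^+ = X X^+ X Z = X Z =
     1. *)
  have /row_freeP[Z XZ] : row_free (ctrmx (lsubmx U) *m Om) by rewrite /row_free rk1.
  by rewrite -[LHS]mulmx1 -XZ mulmxA XYX.
have head := det_1add_head_le UU eA lamk1 lamk _ bmu q0 Om1 QQ eK.
have gL2 : gram Lam2.
  by apply: gram_diag => i; rewrite mxE ler0c; have /andP[] := bmu i.
have geL2 : gram (eta%:C *: Lam2) by apply: gramZ; rewrite ?ler0c.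
have detA : \det (1%:M + A) = \det (1%:M + diag_mx d1) * \det (1%:M + Lam2).
  rewrite eA -mulmxA det_1addM_comm -mulmxA [_ *m U]UU mulmx1.
  rewrite diag_mx_row (@scalar_mx_block _ k m) add_block_mx !addr0.
  exact: det_ublock.
rewrite /logdet subr_ge0; split.
  apply: ler_ln_Re; first exact: det_1add_gram_gt0.
  exact: det_1add_compression.
rewrite lerBlDr -!ln_Re_mul ?mulr_gt0 ?det_1add_gram_gt0//.
apply: ler_ln_Re; first exact: det_1add_gram_gt0.
(* The tail factor det(1 + Lambda_2) is common to both sides; what remains is [head]. *)
rewrite detA mulrAC; apply: ler_wpM2r; first exact/ltW/det_1add_gram_gt0.
rewrite mulrC; apply: head => i.
by apply: lam_dec; rewrite ?leq_addr.
Qed.
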